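(* There exists a function $f\in L_1(\mathbb T)$ for which $x=0$ is a $d$-point and for which the sequence $\sigma_n(f;0)$ diverges as $n\to\infty$.
   Context: $\mathbb T=[-\pi,\pi]$; functions in $L_1(\mathbb T)$ are integrable on $[-\pi,\pi]$ and extended $2\pi$-periodically to $\mathbb R$; $\widehat f_k=\frac1{2\pi}\int_{-\pi}^{\pi}f(t)e^{-ikt}\,dt$. The $(C,1)$-means are $\sigma_n(f;x)=\sum_{k=-n}^n\bigl(1-\frac{|k|}{n+1}\bigr)\widehat f_k e^{ikx}$. A point $x$ is a $d$-point of $f$ if the (finite) limit $d_f(x)=\lim_{h\to0}\frac1h\int_0^h f(x+t)\,dt$ exists (two-sided). ''Diverges'' means: has no finite limit. *)

(* Defs.v *)
From HB Require Import structures.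
From mathcomp Require Import all_boot all_order all_algebra.
From mathcomp Require Import complex.
From mathcomp Require Import all_classical all_reals all_analysis.

Set Implicit Arguments.
Unset Strict Implicit.
Unset Printing Implicit Defensive.

Import Order.TTheory GRing.Theory Num.Theory.
Import numFieldNormedType.Exports.

Local Open Scope classical_set_scope.
Local Open Scope ring_scope.
Local Open Scope complex_scope.

Section ComplexIntegral.
Context {R : realType}.
Local Notation mu := (@lebesgue_measure R).

Definition Cintegrable (D : set R) (f : R -> R[i]) : Prop :=
  mu.-integrable D (fun t => (complex.Re (f t))%:E) /\
  mu.-integrable D (fun t => (complex.Im (f t))%:E).

Definition Cintegral (D : set R) (f : R -> R[i]) : R[i] :=
  (\int[mu]_(t in D) complex.Re (f t)) +i*
  (\int[mu]_(t in D) complex.Im (f t)).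

(* Oriented integral from a to b: the sign is reversed when b < a. *)
Definition Cintegral_oriented (a b : R) (f : R -> R[i]) : R[i] :=
  if a <= b then Cintegral `[a, b] f else - Cintegral `[b, a] f.

Definition expi (t : R) : R[i] := cos t +i* sin t.

End ComplexIntegral.

Section Fourier.
Context {R : realType}.
Implicit Types (f : R -> R[i]) (x : R) (k : int) (n : nat).

(* L_1 of the circle: complex-valued functions on the line, of period 2 pi,
   Lebesgue integrable over one period. *)
Definition L1T f : Prop :=
  periodic f (pi *+ 2) /\ Cintegrable `[- pi, pi] f.

Definition fourier_coef f k : R[i] :=
  ((pi *+ 2)^-1)%:C *
  Cintegral `[- pi, pi] (fun t => f t * expi (- (k%:~R * t))).

(* The summation index i in 0, ..., 2n encodes the frequency k = i - n,
   which runs over -n, ..., n. *)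
Definition fejer_mean f n x : R[i] :=
  \sum_(i < n.*2.+1)
    let k : int := i%:Z - n%:Z in
    (1 - `|k|%:~R / n.+1%:R)%:C * fourier_coef f k * expi (k%:~R * x).

(* The limit is over the punctured neighbourhoods of 0, on both sides.
   The alias R[i]^o carries the topology of the modulus. *)
Definition d_point f x : Prop :=
  cvg ((fun h : R =>
    (h^-1)%:C * Cintegral_oriented 0 h (fun t => f (x + t)) : R[i]^o) @ 0^').

End Fourier.

(* Main.v *)
Require Import Defs.
From mathcomp Require Import all_boot all_order all_algebra.
From mathcomp Require Import complex.
From mathcomp Require Import all_classical all_reals all_analysis.
From mathcomp Require Import measurable_realfun ring lra zify.

Import Order.TTheory GRing.Theory Num.Theory.
Import numFieldNormedType.Exports.

Local Open Scope classical_set_scope.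
Local Open Scope ring_scope.

(** The construction is a gliding hump, carried by waves that resonate with the
    Fejer kernel.

    At 0 the Fejer mean of order n is (1 / 2 pi) times the integral of f K, where
    (1 - cos t) K(t) = (1 - cos(Mt)) / M and M = n + 1 ([fejer_kernelE]). Suppose
    that on a dyadic interval I_j = ]2 pi / 2^(j+1), 2 pi / 2^j] the function f is
    the derivative of F(t) = - e 2^j (1 - cos t) sin(Mt), with M divisible by
    2^(j+1). Since F vanishes at both ends of I_j, such pieces can be glued, and
    the integral of f over [0, h] is F(h), of absolute value at most a constant
    times e h ([Rintegral_staircase]): if e tends to 0 as j grows, then 0 is a
    d-point, with limit 0. On the other hand, f K is close to
    e 2^j (cos(Mt)^2 - cos(Mt)), whose integral over I_j is of the order of e, no
    matter how small the interval is ([Rintegral_fejer_resonant_ge]). Many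
    consecutive intervals carrying the same frequency M therefore produce a large
    Fejer mean.

    The levels j are arranged in blocks. With q = 4^k, the k-th block uses the
    levels 2q <= j < 3q, the frequency M = 16 * 8^q and the amplitude e = 2^-k.
    Its q intervals contribute at least q 2^-k / 2 = 2^k / 2 to the integral of
    f K ([Rintegral_fejer_main]), while e tends to 0. In the k-th block
    t <= 2 pi / 4^q, which gives |f(t)| <= C / sqrt t with C independent of k
    ([gliding_hump_bound]); so f is integrable. The other blocks contribute a
    bounded amount to the Fejer mean of order M - 1: the earlier ones are supported
    where |K| <= 1 ([Rintegral_fejer_high]), and the later ones are supported in
    ]0, 2 pi / 2^(8q)], where |K| <= 2M and where the integral of |f| is at most a
    constant times 16^-q ([Rintegral_fejer_low]). Hence the means of order M - 1
    tend to infinity. *)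

(** * Elementary trigonometric inequalities *)
Section Trigonometry.
Context {R : realType}.
Implicit Types t : R.

Lemma norm_sin_le t : `|sin t| <= `|t|.
Proof.
wlog t0 : t / 0 <= t.
  move=> th; have [/th//|t0] := leP 0 t.
  by have := th (- t); rewrite sinN !normrN; apply; lra.
have [|c _] := @MVT_segment R sin cos 0 t t0.
- by apply: continuous_subspaceT => x; exact: continuous_sin.
by rewrite sin0 !subr0 => ->; rewrite normrM ler_piMl// cos_max.
Qed.

Lemma oneBcosE t : 1 - cos t = (sin (t / 2)) ^+ 2 *+ 2.
Proof.
have {1}-> : t = (t / 2) *+ 2 by rewrite -mulr_natr divfK.
by rewrite cos_mulr2n cos2sin2; ring.
Qed.

Lemma oneBcos_ge0 t : 0 <= 1 - cos t.
Proof. by rewrite subr_ge0 cos_le1. Qed.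

Lemma oneBcos_le t : 1 - cos t <= t ^+ 2 / 2.
Proof.
have : sin (t / 2) ^+ 2 <= (t / 2) ^+ 2.
  by rewrite -real_normK ?num_real// -[leRHS]real_normK ?num_real// lerXn2r ?nnegrE// norm_sin_le.
rewrite oneBcosE; lra.
Qed.

(** On [0, pi/4] the cosine is at least 1/2, so the mean value
    theorem gives sin x >= x/2 there, and 1 - cos t = 2 sin(t/2)^2. *)
Lemma oneBcos_ge t : 0 <= t <= pi / 2 -> t ^+ 2 / 8 <= 1 - cos t.
Proof.
move=> /andP[t0 tpi]; have pi4 := @pihalf_lt2 R.
have t20 : 0 <= t / 2 by lra.
have [|c] := @MVT_segment R sin cos 0 (t / 2) t20.
- by apply: continuous_subspaceT => x; exact: continuous_sin.
rewrite in_itv /= => /andP[c0 ct]; rewrite sin0 !subr0 => st.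
have c2 : c ^+ 2 <= 1 by rewrite expr_le1//; lra.
have cc : 1 / 2 <= cos c by have := oneBcos_le c; lra.
have st2 : t / 4 <= sin (t / 2) by rewrite st; nra.
rewrite oneBcosE; nra.
Qed.

Lemma sin_2pi_nat (n : nat) : sin (pi *+ 2 * n%:R) = 0 :> R.
Proof. by rewrite mulr_natr -[_ *+ n]add0r periodicn ?sin0//; exact: sinD2pi. Qed.

End Trigonometry.

(** * The Fejer kernel *)
Section FejerKernel.
Context {R : realType}.
Implicit Types t : R.

(** The indexing follows that of [fejer_mean]: the summation index i stands for
    the frequency i - n. *)
Definition fejer_kernel (n : nat) t : R :=
  \sum_(i < n.*2.+1)
    (1 - `|i%:Z - n%:Z|%:~R / n.+1%:R) * cos ((i%:Z - n%:Z)%:~R * t).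

Lemma sum_symmetric (g : int -> R) n :
  \sum_(i < n.*2.+1) g (i%:Z - n%:Z) =
  g 0 + \sum_(i < n) (g i.+1%:Z + g (- i.+1%:Z)).
Proof.
elim: n g => [|n IH] g; first by rewrite big_ord1 big_ord0 subr0 addr0.
rewrite doubleS big_ord_recl big_ord_recr /= [in RHS]big_ord_recr/=.
rewrite [RHS]addrA -IH addrCA [X in _ + X]addrC; congr (_ + (g _ + g _)).
- apply: eq_bigr => i _; congr g; rewrite /bump /= add1n; lia.
- rewrite /bump /=; lia.
- lia.
Qed.

(** The Dirichlet kernel telescopes after multiplication by 1 - cos t, because
    2 (1 - cos t) cos(kt) is minus the second difference of cos(kt) in k. *)
Lemma oneBcos_dirichlet t n :
  (1 - cos t) * (1 + 2 * \sum_(i < n) cos (i.+1%:R * t)) =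
  cos (n%:R * t) - cos (n.+1%:R * t).
Proof.
elim: n => [|n IH]; first by rewrite big_ord0 mul0r mul1r cos0; ring.
rewrite big_ord_recr/= [2 * _]mulrDr addrA [LHS]mulrDr IH.
have -> : n%:R * t = n.+1%:R * t - t by rewrite -natr1; ring.
have -> : n.+2%:R * t = n.+1%:R * t + t by rewrite -natr1; ring.
rewrite cosB cosD; ring.
Qed.

(** The unnormalised Fejer kernel is the sum of the first Dirichlet kernels, so
    the identity follows by telescoping once more. *)
Lemma oneBcos_fejer_sum t n :
  (1 - cos t) * (n.+1%:R + 2 * \sum_(i < n) (n.+1%:R - i.+1%:R) * cos (i.+1%:R * t)) =
  1 - cos (n.+1%:R * t).
Proof.
elim: n => [|n IH]; first by rewrite big_ord0 mulr0 addr0 mulr1 mul1r.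
have -> : n.+2%:R + 2 * \sum_(i < n.+1) (n.+2%:R - i.+1%:R) * cos (i.+1%:R * t) =
   (n.+1%:R + 2 * \sum_(i < n) (n.+1%:R - i.+1%:R) * cos (i.+1%:R * t)) +
   (1 + 2 * \sum_(i < n.+1) cos (i.+1%:R * t)).
  rewrite !big_ord_recr /=.
  under eq_bigr => i _.
    rewrite (_ : (n.+2%:R - _) * _ = (n.+1%:R - i.+1%:R) * cos (i.+1%:R * t) + cos (i.+1%:R * t)); last first.
      by rewrite -[n.+2%:R]natr1; ring.
    over.
  rewrite big_split/= -[n.+2%:R]natr1; ring.
by rewrite mulrDr IH oneBcos_dirichlet; ring.
Qed.

(** The closed form of the kernel, kept as a product because it is the factor
    1 - cos t that the gliding hump supplies. *)
Lemma fejer_kernelE n t :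
  (1 - cos t) * fejer_kernel n t = (1 - cos (n.+1%:R * t)) / n.+1%:R.
Proof.
have n0 : n.+1%:R != 0 :> R by rewrite pnatr_eq0.
rewrite -oneBcos_fejer_sum -mulrA; congr (_ * _).
rewrite /fejer_kernel.
rewrite (sum_symmetric (fun k => (1 - `|k|%:~R / n.+1%:R) * cos (k%:~R * t))).
rewrite normr0 mul0r subr0 mul0r cos0 mulr1.
under eq_bigr => i _.
  rewrite normrN mulrNz mulNr cosN -mulr2n.
  rewrite (_ : _ *+ 2 = 2 * (n.+1%:R - i.+1%:R) * cos (i.+1%:R * t) / n.+1%:R); last first.
    by rewrite ger0_norm//=; field.
  over.
rewrite -mulr_suml mulrDl divff//; congr (_ + _ / _).
by rewrite mulr_sumr; apply: eq_bigr => i _; rewrite mulrA.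
Qed.

Lemma fejer_kernel_le n t : `|fejer_kernel n t| <= 2 * n.+1%:R.
Proof.
apply: (le_trans (ler_norm_sum _ _ _)).
apply: (@le_trans _ _ (\sum_(i < n.*2.+1) 1)); last first.
  rewrite sumr_const card_ord -natrM ler_nat; lia.
apply: ler_sum => i _; rewrite normrM mulr_ile1 ?cos_max//.
rewrite ger0_norm.
  by rewrite lerBlDr lerDl divr_ge0// ler0z.
rewrite subr_ge0 ler_pdivrMr ?ltr0n// mul1r -[n.+1%:R]/(n.+1%:Z%:~R) ler_int.
have := ltn_ord i; lia.
Qed.

Lemma fejer_kernel_decay n t : 0 < t <= pi / 2 ->
  `|fejer_kernel n t| <= 16 / (n.+1%:R * t ^+ 2).
Proof.
move=> /andP[t0 tpi]; have t2 : 0 < t ^+ 2 by rewrite exprn_gt0.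
rewrite ler_pdivlMr ?mulr_gt0//.
have /(congr1 Num.norm) := fejer_kernelE n t.
rewrite !normrM (ger0_norm (oneBcos_ge0 t)) normfV normr_nat => E.
have lo : t ^+ 2 / 8 * `|fejer_kernel n t| <= (1 - cos t) * `|fejer_kernel n t|.
  by rewrite ler_wpM2r// oneBcos_ge// ltW.
have : (1 - cos t) * `|fejer_kernel n t| * n.+1%:R <= 2.
  rewrite E divfK ?pnatr_eq0// ger0_norm ?oneBcos_ge0//.
  by have := cos_geN1 (n.+1%:R * t); lra.
have := ler_wpM2r (ler0n R n.+1) lo; nra.
Qed.

Lemma measurable_fejer_kernel n (D : set R) :
  measurable_fun D (fejer_kernel n).
Proof.
apply: measurable_funTS; apply: measurable_sum => i.
apply: measurable_funM; first exact: measurable_cst.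
apply: measurableT_comp.
  exact: (continuous_measurable_fun (@continuous_cos R)).
exact: mulrl_measurable.
Qed.

End FejerKernel.

(** * Integrals over half-open intervals and domination by an inverse square root *)
Section Integration.
Context {R : realType}.
Local Notation mu := (@lebesgue_measure R).
Implicit Types (f F : R -> R) (a b c : R).

Lemma integrable_oc_within f a b : {within `[a, b], continuous f} ->
  mu.-integrable `]a, b] (EFin \o f).
Proof.
move=> cf; have fi : mu.-integrable `[a, b] (EFin \o f).
  by apply: continuous_compact_integrable => //; exact: segment_compact.
by apply: integrableS fi => //; exact: subset_itv_oc_cc.
Qed.

Lemma continuous_within_invsqrt a b : 0 < a ->
  {within `[a, b], continuous (fun t : R => (Num.sqrt t)^-1)}.
Proof.
move=> a0; apply: continuous_in_subspaceT => x; rewrite inE/= in_itv/=.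
move=> /andP[ax _]; apply: cvgV; last exact: sqrt_continuous.
by rewrite gt_eqF// sqrtr_gt0 (lt_le_trans a0).
Qed.

(** The differentiability hypothesis is one-sided in x so that the lemma also
    covers the square root on an interval that stays away from 0. *)
Lemma Rintegral_oc_FTC f F a b : a <= b -> {within `[a, b], continuous f} ->
  (forall x, a <= x -> is_derive x 1 F (f x)) ->
  \int[mu]_(x in `]a, b]) f x = F b - F a.
Proof.
rewrite le_eqVlt => /predU1P[<- _ _|ab cf dF].
  by rewrite set_itvoc0 Rintegral_set0 subrr.
have cF x : a <= x -> {for x, continuous F}.
  move=> ax; apply: differentiable_continuous.
  by apply/derivable1_diffP; have [] := dF x ax.
rewrite Rintegral_itv_obnd_cbnd; last exact: integrable_oc_within.
rewrite /Rintegral (@continuous_FTC2 _ f F)//.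
- split.
  + move=> x /[!in_itv]/= /andP[ax _].
    by have [] := dF x (ltW ax).
  + exact/cvg_at_right_filter/cF.
  + exact/cvg_at_left_filter/cF/ltW.
- move=> x /[!in_itv]/= /andP[ax _].
  by rewrite derive1E; have := dF x (ltW ax) => ?; rewrite derive_val.
Qed.

Lemma Rintegral_oc_cat f a b c : a <= b <= c ->
  mu.-integrable `]a, c] (EFin \o f) ->
  \int[mu]_(x in `]a, c]) f x =
  \int[mu]_(x in `]a, b]) f x + \int[mu]_(x in `]b, c]) f x.
Proof.
move=> /andP[ab bc] fi; rewrite -(@Rintegral_itvB _ _ _ _ b fi).
- by rewrite addrC subrK.
- by rewrite bnd_simp.
- by rewrite bnd_simp.
Qed.

Lemma Rintegral_invsqrt a b : 0 < a -> a <= b ->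
  \int[mu]_(x in `]a, b]) (Num.sqrt x)^-1 = 2 * Num.sqrt b - 2 * Num.sqrt a.
Proof.
move=> a0 ab; apply: (@Rintegral_oc_FTC _ (fun x => 2 * Num.sqrt x)) => //.
- exact: continuous_within_invsqrt.
- move=> x ax; have x0 : 0 < x by exact: lt_le_trans ax.
  have h := is_derive1_sqrt x0.
  apply: is_derive_eq.
  by rewrite invfM [LHS]mulVKf.
Qed.

(** The interval ]0, b] is exhausted by the intervals ]b/(n+1), b], on which the
    fundamental theorem of calculus bounds the integral uniformly in n. *)
Lemma integral_dominated_invsqrt f C b : 0 < b -> 0 <= C ->
  measurable_fun `]0, b] f ->
  {in `]0, b], forall t, `|f t| <= C / Num.sqrt t} ->
  (\int[mu]_(t in `]0%R, b]) `|(f t)%:E| <= (2 * C * Num.sqrt b)%:E)%E.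
Proof.
move=> b0 C0 mf fC.
pose E n : set R := `]b / n.+1%:R, b]%classic.
have bn n : 0 < b / n.+1%:R by rewrite divr_gt0.
have EE : `]0, b]%classic = \bigcup_n E n.
  apply/seteqP; split => t; rewrite /E /= in_itv/=.
    move=> /andP[t0 tb]; exists (Num.truncn (b / t)) => //=; rewrite in_itv/= tb andbT.
    by rewrite ltr_pdivrMr// mulrC -ltr_pdivrMr// truncnS_gt.
  move=> [n _] /=; rewrite in_itv/= => /andP[nt ->].
  by rewrite andbT (lt_trans _ nt).
have ndE : nondecreasing_seq E.
  move=> m n mn; apply/subsetPset => t; rewrite /E /= !in_itv /= => /andP[mt ->].
  rewrite andbT (le_lt_trans _ mt)// ler_pM2l// lef_pV2 ?posrE ?ltr0n//.
  by rewrite ler_nat.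
have mE n : measurable (E n) by exact: measurable_itv.
have mfE n : measurable_fun (E n) (fun t => `|(f t)%:E|%E).
  apply: measurableT_comp => //; apply/measurable_EFinP.
  by apply: measurable_funS mf => //; rewrite EE; exact: bigcup_sup.
have cvE : (\int[mu]_(t in E n) `|(f t)%:E| @[n --> \oo] -->
    \int[mu]_(t in \bigcup_n E n) `|(f t)%:E|)%E.
  exact: ge0_nondecreasing_set_cvg_integral.
rewrite EE -(cvg_lim _ cvE)//; apply: lime_le.
  by apply/cvg_ex; eexists; exact: cvE.
apply: nearW => n.
have isq : mu.-integrable (E n) (EFin \o (fun t => (Num.sqrt t)^-1)).
  exact/integrable_oc_within/continuous_within_invsqrt.
have iCsq : mu.-integrable (E n) (EFin \o (fun t => C * (Num.sqrt t)^-1)).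
  apply: integrable_oc_within => x; apply: cvgM; first exact: cvg_cst.
  exact: continuous_within_invsqrt.
apply: (@le_trans _ _ (\int[mu]_(t in E n) (C * (Num.sqrt t)^-1)%:E)%E).
  apply: ge0_le_integral => //.
  - exact: mE.
  - exact: mfE.
  - exact: (measurable_int mu iCsq).
  - move=> t; rewrite /E/= in_itv/= => /andP[nt tb].
    rewrite lee_fin fC// in_itv/= tb andbT (lt_trans _ nt)//.
rewrite -[leLHS]fineK; last first.
  by apply: integrable_fin_num iCsq; exact: mE.
rewrite lee_fin -/(Rintegral _ _ _) RintegralZl; [|exact: mE|exact: isq].
rewrite Rintegral_invsqrt//; last by rewrite ler_pdivrMr// ler_peMr ?ler1n// ltW.
rewrite -mulrBr [2 * C]mulrC -mulrA ler_wpM2l// ler_pM2l// gerBl.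
exact: sqrtr_ge0.
Qed.

Lemma integrable_dominated_invsqrt f C b : 0 < b -> 0 <= C ->
  measurable_fun `]0, b] f ->
  {in `]0, b], forall t, `|f t| <= C / Num.sqrt t} ->
  mu.-integrable `]0, b] (EFin \o f).
Proof.
move=> b0 C0 mf fC; apply/integrableP; split; first exact/measurable_EFinP.
exact: le_lt_trans (integral_dominated_invsqrt f C b b0 C0 mf fC) (ltry _).
Qed.

Lemma norm_Rintegral0_dominated_invsqrt f C b : 0 < b -> 0 <= C ->
  measurable_fun `]0, b] f ->
  {in `]0, b], forall t, `|f t| <= C / Num.sqrt t} ->
  `|\int[mu]_(t in `]0, b]) f t| <= 2 * C * Num.sqrt b.
Proof.
move=> b0 C0 mf fC; have fi := integrable_dominated_invsqrt f C b b0 C0 mf fC.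
rewrite -lee_fin EFin_normr_Rintegral//.
apply: le_trans (integral_dominated_invsqrt f C b b0 C0 mf fC).
apply: le_abse_integral => //; exact/measurable_EFinP.
Qed.

Lemma norm_Rintegral_dominated_invsqrt f C a b : 0 < a -> a <= b -> 0 <= C ->
  mu.-integrable `]a, b] (EFin \o f) ->
  {in `]a, b], forall t, `|f t| <= C / Num.sqrt t} ->
  `|\int[mu]_(t in `]a, b]) f t| <= 2 * C * Num.sqrt b.
Proof.
move=> a0 ab C0 fi fC.
have isq : mu.-integrable `]a, b] (EFin \o (fun t => (Num.sqrt t)^-1)).
  exact/integrable_oc_within/continuous_within_invsqrt.
have iCsq : mu.-integrable `]a, b] (EFin \o (fun t => C * (Num.sqrt t)^-1)).
  apply: integrable_oc_within => x; apply: cvgM; first exact: cvg_cst.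
  exact: continuous_within_invsqrt.
apply: (@le_trans _ _ (\int[mu]_(t in `]a, b]) (C * (Num.sqrt t)^-1))).
  apply: (le_trans (le_normr_Rintegral _ fi)) => //.
  apply: le_Rintegral => //.
  exact: integrable_norm fi.
rewrite RintegralZl// Rintegral_invsqrt// -mulrBr [2 * C]mulrC -mulrA.
by rewrite ler_wpM2l// ler_pM2l// gerBl sqrtr_ge0.
Qed.

End Integration.

(** * The dyadic partition of a period *)
Section Dyadic.
Context {R : realType}.
Implicit Types t : R.

Lemma pi2_gt0 : 0 < pi *+ 2 :> R.
Proof. by rewrite mulr2n addr_gt0// pi_gt0. Qed.

(** The right ends of the intervals ]2 pi / 2^(j+1), 2 pi / 2^j]; a frequency
    divisible by 2^j has a whole number of periods in [0, dyadic j]. *)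
Definition dyadic j : R := pi *+ 2 / 2 ^+ j.

(** The index j of the dyadic interval that contains t. Outside ]0, 2 pi] the
    truncation makes it 0. *)
Definition level t : nat := trunc_log 2 (Num.truncn (pi *+ 2 / t)).

Lemma dyadic_gt0 j : 0 < dyadic j.
Proof. by rewrite divr_gt0 ?exprn_gt0// pi2_gt0. Qed.

Lemma dyadic1 : dyadic 1 = pi.
Proof. by rewrite /dyadic expr1 -[pi *+ 2]mulr_natr mulfK. Qed.

Lemma dyadicS j : dyadic j.+1 = dyadic j / 2.
Proof. by rewrite /dyadic exprS invfM; ring. Qed.

Lemma dyadic_half j : dyadic j = dyadic j.+1 * 2.
Proof. by rewrite dyadicS divfK. Qed.

Lemma dyadic_anti i j : (i <= j)%N -> dyadic j <= dyadic i.
Proof.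
move=> ij; rewrite /dyadic ler_pM2l ?pi2_gt0// lef_pV2 ?posrE ?exprn_gt0//.
by rewrite ler_weXn2l// ler1n.
Qed.

Lemma dyadic_le2pi j : dyadic j <= pi *+ 2.
Proof. by rewrite (le_trans (dyadic_anti _ _ (leq0n j)))// /dyadic expr0 divr1. Qed.

Lemma dyadicM j : dyadic j * 2 ^+ j = pi *+ 2.
Proof. by rewrite divfK// expf_neq0. Qed.

Lemma cvg_dyadic : dyadic j @[j --> \oo] --> 0.
Proof.
rewrite (_ : dyadic = (fun j => pi *+ 2 * 2^-1 ^+ j)); last first.
  by apply/funext => j; rewrite /dyadic exprVn.
rewrite -[X in _ --> X](mulr0 (pi *+ 2)); apply: cvgM; first exact: cvg_cst.
by apply: cvg_expr; rewrite ger0_norm//; lra.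
Qed.

Lemma level_max t j : 0 < t <= dyadic j -> (j <= level t)%N.
Proof.
move=> /andP[t0 tj]; apply: trunc_log_max => //.
rewrite truncn_ge_nat ?divr_ge0 ?(ltW t0) ?(ltW pi2_gt0)//.
by rewrite natrX ler_pdivlMr// mulrC -ler_pdivlMr ?exprn_gt0.
Qed.

Lemma level_bounds t : 0 < t <= pi *+ 2 ->
  dyadic (level t).+1 < t <= dyadic (level t).
Proof.
move=> /andP[t0 t2].
have x1 : 1 <= pi *+ 2 / t by rewrite ler_pdivlMr// mul1r.
have m0 : (0 < Num.truncn (pi *+ 2 / t))%N by rewrite truncn_gt0.
apply/andP; split.
  rewrite ltr_pdivrMr ?exprn_gt0// mulrC -ltr_pdivrMr//.
  apply: (lt_le_trans (truncnS_gt _)).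
  by rewrite -natrX ler_nat trunc_log_ltn.
rewrite ler_pdivlMr ?exprn_gt0// mulrC -ler_pdivlMr//.
have /andP[xm _] := truncn_itv (le_trans ler01 x1).
apply: le_trans xm.
by rewrite -natrX ler_nat trunc_logP.
Qed.

Lemma level_eq t j : dyadic j.+1 < t <= dyadic j -> level t = j.
Proof.
move=> /andP[jt tj]; have t0 : 0 < t by rewrite (lt_trans (dyadic_gt0 _) jt).
apply/eqP; rewrite eqn_leq level_max ?t0// andbT leqNgt; apply/negP => jl.
have /andP[_] : dyadic (level t).+1 < t <= dyadic (level t).
  by apply: level_bounds; rewrite t0 (le_trans tj)// dyadic_le2pi.
by rewrite leNgt (le_lt_trans _ jt)// dyadic_anti.
Qed.

Lemma level_le0 t : t <= 0 -> level t = 0%N.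
Proof.
move=> t0; rewrite /level (truncn0Pn _ _) ?trunc_log0//.
by rewrite -ltNge (le_lt_trans _ ltr01)// mulr_ge0_le0 ?invr_le0// ltW// pi2_gt0.
Qed.

Lemma level_lt t j : dyadic j < t <= pi *+ 2 -> (level t < j)%N.
Proof.
move=> /andP[jt t2]; rewrite ltnNge; apply/negP => jl.
have t0 : 0 < t by rewrite (lt_trans (dyadic_gt0 _) jt).
have /andP[_] := level_bounds _ (introT andP (conj t0 t2)).
by rewrite leNgt (le_lt_trans _ jt)// dyadic_anti.
Qed.

End Dyadic.

(** * Waves and their primitives *)
Section Wave.
Context {R : realType}.
Local Notation mu := (@lebesgue_measure R).
Implicit Types (t : R) (n : nat).

Definition wave_primitive n t : R := (1 - cos t) * sin (n%:R * t).

(** The derivative of [wave_primitive n]. The factor 1 - cos t of the primitive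
    cancels the denominator of the Fejer kernel, and it is what makes the
    primitive quadratically small at 0. *)
Definition wave n t : R :=
  n%:R * (1 - cos t) * cos (n%:R * t) + sin t * sin (n%:R * t).

Lemma is_derive_wave n t : is_derive t 1 (wave_primitive n) (wave n t).
Proof.
apply: is_derive_eq; rewrite /wave /GRing.scale/=; ring.
Qed.

Lemma continuous_sin_scaled n : continuous (fun t => sin (n%:R * t) : R).
Proof.
move=> t; apply: continuous_comp; last exact: continuous_sin.
by apply: cvgM; [exact: cvg_cst|exact: cvg_id].
Qed.

Lemma continuous_cos_scaled n : continuous (fun t => cos (n%:R * t) : R).
Proof.
move=> t; apply: continuous_comp; last exact: continuous_cos.
by apply: cvgM; [exact: cvg_cst|exact: cvg_id].
Qed.

Lemma continuous_wave n : continuous (wave n).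
Proof.
move=> t; apply: cvgD.
  apply: cvgM; last exact: continuous_cos_scaled.
  apply: cvgM; first exact: cvg_cst.
  by apply: cvgB; [exact: cvg_cst|exact: continuous_cos].
by apply: cvgM; [exact: continuous_sin|exact: continuous_sin_scaled].
Qed.

Lemma Rintegral_wave n a b : a <= b ->
  \int[mu]_(t in `]a, b]) wave n t = wave_primitive n b - wave_primitive n a.
Proof.
move=> ab; apply: Rintegral_oc_FTC => //.
  exact/continuous_subspaceT/continuous_wave.
by move=> x _; exact: is_derive_wave.
Qed.

Lemma wave_le n t : 0 <= t -> `|wave n t| <= n%:R * (t ^+ 2 / 2) + t.
Proof.
move=> t0; apply: (le_trans (ler_normD _ _)); apply: lerD.
  rewrite !normrM normr_nat (ger0_norm (oneBcos_ge0 t)) -[leRHS]mulr1.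
  apply: ler_pM => //.
    by rewrite ler_wpM2l// oneBcos_le.
  exact: cos_max.
rewrite normrM -[leRHS]mulr1; apply: ler_pM => //; last exact: sin_max.
by rewrite (le_trans (norm_sin_le t))// ger0_norm.
Qed.

Lemma wave_primitive_le n t : `|wave_primitive n t| <= t ^+ 2 / 2.
Proof.
rewrite normrM -[leRHS]mulr1; apply: ler_pM => //; last exact: sin_max.
by rewrite ger0_norm ?oneBcos_ge0// oneBcos_le.
Qed.

(** This vanishing is what allows waves with different frequencies to be glued
    at dyadic points without creating any mean value. *)
Lemma wave_primitive_dyadic n j : (2 ^ j %| n)%N ->
  wave_primitive n (dyadic j) = 0.
Proof.
move=> /dvdnP[m ->]; rewrite /wave_primitive natrM natrX.
by rewrite -mulrA [2 ^+ j * _]mulrC dyadicM mulrC [m%:R * _]mulrC sin_2pi_nat mul0r.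
Qed.

End Wave.

(** * Functions glued from waves over the dyadic partition *)
Section Staircase.
Context {R : realType}.
Local Notation mu := (@lebesgue_measure R).
Variables (a : nat -> R) (N : nat -> nat) (C : R).
Implicit Types t h : R.

Definition staircase t : R := a (level t) * wave (N (level t)) t.

Hypothesis N_dyadic : forall j, a j != 0 -> (2 ^ j.+1 %| N j)%N.
Hypothesis C_ge0 : 0 <= C.
Hypothesis staircase_le :
  forall t, 0 < t <= pi *+ 2 -> `|staircase t| <= C / Num.sqrt t.

Lemma staircaseE j t : dyadic j.+1 < t <= dyadic j ->
  staircase t = a j * wave (N j) t.
Proof. by move=> /level_eq <-. Qed.

Lemma oc_bigcup_dyadic :
  `]0, pi *+ 2]%classic = \bigcup_j `](dyadic j.+1 : R), dyadic j]%classic.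
Proof.
apply/seteqP; split => [t /=|t [j _] /=]; rewrite !in_itv/=.
  by move=> t02; exists (level t) => //=; rewrite in_itv/= level_bounds.
move=> /andP[jt tj]; rewrite (lt_trans (dyadic_gt0 _) jt)/=.
by rewrite (le_trans tj)// dyadic_le2pi.
Qed.

Lemma measurable_staircase : measurable_fun `]0, pi *+ 2] staircase.
Proof.
rewrite oc_bigcup_dyadic; apply/measurable_fun_bigcup => j; first exact: measurable_itv.
apply: (@eq_measurable_fun _ _ _ _ _ (fun t => a j * wave (N j) t)).
  by move=> t; rewrite inE/= in_itv/= => /staircaseE ->.
apply: measurable_funM; first exact: measurable_cst.
apply: measurable_funTS; apply: continuous_measurable_fun; exact: continuous_wave.
Qed.

Lemma integrable_staircase h : h <= pi *+ 2 ->
  mu.-integrable `]0, h] (EFin \o staircase).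
Proof.
move=> h2; have : mu.-integrable `]0, pi *+ 2] (EFin \o staircase).
  apply: (integrable_dominated_invsqrt _ C) measurable_staircase _ => //; exact: pi2_gt0.
by move=> i; apply: integrableS i => //; exact: subset_itvl.
Qed.

Lemma Rintegral_staircase_dyadic j h : dyadic j.+1 <= h <= dyadic j ->
  \int[mu]_(t in `]dyadic j.+1, h]) staircase t = a j * wave_primitive (N j) h.
Proof.
move=> /andP[jh hj].
transitivity (\int[mu]_(t in `]dyadic j.+1, h]) (a j * wave (N j) t)).
  apply: eq_Rintegral => t; rewrite inE/= in_itv/= => /andP[jt th].
  by apply: staircaseE; rewrite jt (le_trans th).
rewrite RintegralZl//; last first.
  exact/integrable_oc_within/continuous_subspaceT/continuous_wave.
rewrite Rintegral_wave//.
have [->|/N_dyadic Nj] := eqVneq (a j) 0; first by rewrite !mul0r.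
by rewrite (wave_primitive_dyadic _ _ Nj) subr0.
Qed.

(** Every dyadic interval contributes 0, so the integral over ]0, dyadic j] is
    the same for all j; the domination by an inverse square root makes it tend
    to 0 with the length of the interval. *)
Lemma Rintegral_staircase0 j : \int[mu]_(t in `]0, dyadic j]) staircase t = 0.
Proof.
set I := (X in X = _).
have step i : \int[mu]_(t in `]0, dyadic i.+1]) staircase t =
              \int[mu]_(t in `]0, dyadic i]) staircase t.
  rewrite [RHS](@Rintegral_oc_cat _ _ _ (dyadic i.+1)).
  - rewrite Rintegral_staircase_dyadic; last by rewrite dyadic_anti ?lexx.
    have [->|Ni] := eqVneq (a i) 0; first by rewrite mul0r addr0.
    rewrite wave_primitive_dyadic ?mulr0 ?addr0//.
    by rewrite (dvdn_trans _ (N_dyadic _ Ni))// expnS dvdn_mull.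
  - by rewrite ltW ?dyadic_gt0// dyadic_anti.
  - exact/integrable_staircase/dyadic_le2pi.
have E k : I = \int[mu]_(t in `]0, dyadic (k + j)]) staircase t.
  by elim: k => [//|k ->]; rewrite addSn step.
have bd k : `|I| <= 2 * C * Num.sqrt (dyadic (k + j)).
  rewrite (E k); apply: (norm_Rintegral0_dominated_invsqrt _ C) => //.
  - exact: dyadic_gt0.
  - apply: measurable_funS measurable_staircase => //.
    by apply: subset_itvl; rewrite bnd_simp dyadic_le2pi.
  - move=> t; rewrite in_itv/= => /andP[t0 tk].
    by apply: staircase_le; rewrite t0 (le_trans tk)// dyadic_le2pi.
have cv : 2 * C * Num.sqrt (dyadic (k + j)) @[k --> \oo] --> (0 : R).
  rewrite -[X in _ --> X](mulr0 (2 * C)) -sqrtr0.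
  apply: cvgM; first exact: cvg_cst.
  apply: continuous_cvg; first exact: sqrt_continuous.
  by have := @cvg_dyadic R; rewrite -(cvg_shiftn j).
apply/eqP; rewrite -normr_le0.
by apply: (cvgr_to_ge cv); exact: nearW.
Qed.

(** Only the dyadic interval that contains h contributes. This is the cancellation
    behind the d-point: the integral is at most |a j| h^2 / 2 for j = level h,
    and both h and 2^-j are of the same order. *)
Lemma Rintegral_staircase h : 0 < h <= pi *+ 2 ->
  \int[mu]_(t in `]0, h]) staircase t =
  a (level h) * wave_primitive (N (level h)) h.
Proof.
move=> hh; have /andP[h0 h2] := hh.
have /andP[/ltW lh hl] := level_bounds _ hh.
rewrite (@Rintegral_oc_cat _ _ _ (dyadic (level h).+1)).
- by rewrite Rintegral_staircase0 add0r Rintegral_staircase_dyadic ?lh.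
- by rewrite ltW ?dyadic_gt0.
- exact: integrable_staircase.
Qed.

End Staircase.

(** * Lacunary blocks of levels *)
Section Blocks.
Implicit Types j k : nat.

(** The k-th block of levels is [4^k, 4^(k+1)[. The ratio 4 leaves a gap between
    the active parts of consecutive blocks. *)
Definition block j := trunc_log 4 j.

Definition active j := (2 * 4 ^ block j <= j < 3 * 4 ^ block j)%N.

(** With q = 4^k, all active levels of the k-th block share the frequency
    N = 16 * 8^q. On those levels t is at most 2 pi / 4^q, so that N is at most
    a constant times t^(-3/2), and N t at most a constant times t^(-1/2): this
    is the source of integrability. The factor 16 makes N t large enough for
    the error term of [fejer_integrand_resonant_ge]. *)
Definition frequency j := (2 ^ (3 * 4 ^ block j + 4))%N.

Lemma block_eq j k : (4 ^ k <= j < 4 ^ k.+1)%N -> block j = k.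
Proof. exact: trunc_log_eq. Qed.

Lemma active_block j k : (2 * 4 ^ k <= j < 3 * 4 ^ k)%N ->
  block j = k /\ active j.
Proof.
move=> jk; have bj : block j = k by apply: block_eq; rewrite expnS; lia.
by rewrite /active bj.
Qed.

Lemma active_below j k : active j -> (j < 2 * 4 ^ k)%N ->
  (4 * 4 ^ block j <= 4 ^ k)%N.
Proof.
move=> /andP[jl _] jk; rewrite -expnS leq_exp2l// ltnNge; apply/negP => kb.
have : (4 ^ k <= 4 ^ block j)%N by rewrite leq_exp2l.
lia.
Qed.

Lemma inactive_gap j k : (3 * 4 ^ k <= j < 8 * 4 ^ k)%N -> ~~ active j.
Proof.
move=> /andP[kj jk]; apply/negP => /andP[jl jr].
have [bk|kb] := leqP (block j) k.
  have : (4 ^ block j <= 4 ^ k)%N by rewrite leq_exp2l.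
  lia.
have : (4 ^ k.+1 <= 4 ^ block j)%N by rewrite leq_exp2l.
rewrite expnS; lia.
Qed.

Lemma active_ge2 j : active j -> (2 <= j)%N.
Proof.
by move=> /andP[+ _]; have := expn_gt0 4 (block j) => /=; lia.
Qed.

End Blocks.

(** * The gliding hump *)
Section GlidingHump.
Context {R : realType}.
Local Notation mu := (@lebesgue_measure R).
Implicit Types (t h : R) (j k : nat).

(** The factor 2^-k tends to 0, which gives the d-point, but slowly enough that
    2^-k times the number 4^k of active levels still tends to infinity. *)
Definition amplitude j : R :=
  if active j then - (2 ^- block j * 2 ^+ j) else 0.

Definition gliding_hump : R -> R := staircase amplitude frequency.

Lemma amplitude_active j : amplitude j != 0 -> active j.
Proof. by rewrite /amplitude; case: ifP => //; rewrite eqxx. Qed.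

Lemma frequency_dyadic j : amplitude j != 0 -> (2 ^ j.+1 %| frequency j)%N.
Proof.
by move=> /amplitude_active /andP[_ jr]; apply: dvdn_exp2l; lia.
Qed.

Lemma norm_amplitude_le j : `|amplitude j| <= 2 ^- block j * 2 ^+ j.
Proof.
rewrite /amplitude; case: ifP => _; last by rewrite normr0 mulr_ge0.
by rewrite normrN ger0_norm// mulr_ge0.
Qed.

Lemma pi2_le8 : pi *+ 2 <= 8 :> R.
Proof. by have := @pihalf_lt2 R; rewrite -mulr_natr; lra. Qed.

Lemma dyadic_double_le j : dyadic (2 * j) <= (3 / 2 ^+ j) ^+ 2 :> R.
Proof.
rewrite expr_div_n -exprM mulnC /dyadic ler_pM2r ?invr_gt0 ?exprn_gt0//.
by apply: (le_trans pi2_le8); lra.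
Qed.

Lemma sqrt_dyadic_double_le j : Num.sqrt (dyadic (2 * j)) <= 3 / 2 ^+ j :> R.
Proof.
rewrite -[leRHS]ger0_norm ?divr_ge0// -sqrtr_sqr ler_wsqrtr//.
exact: dyadic_double_le.
Qed.

Lemma level_mul_le t : 0 < t <= pi *+ 2 -> 2 ^+ level t * t <= 8.
Proof.
move=> /level_bounds/andP[_ tl]; apply: le_trans pi2_le8.
by rewrite -(dyadicM (level t)) mulrC ler_pM2r// exprn_gt0.
Qed.

(** At level j of the k-th block, 2^j t <= 8 gives |f(t)| <= 8 (N t / 2 + 1),
    and t <= 9 / 4^q with q = 4^k bounds both N t sqrt t and sqrt t. *)
Lemma gliding_hump_bound : exists2 C : R, 0 <= C &
  forall t, 0 < t <= pi *+ 2 -> `|gliding_hump t| <= C / Num.sqrt t.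
Proof.
have [C [C0 CE]] : exists C : R, 0 <= C /\ C = 1760.
  by exists 1760; split; [exact: ler0n|].
exists C => // t tt; have /andP[t0 _] := tt; have s0 : 0 < Num.sqrt t by rewrite sqrtr_gt0.
rewrite /gliding_hump /staircase; set j := level t.
have [->|/amplitude_active aj] := eqVneq (amplitude j) 0.
  by rewrite mul0r normr0 divr_ge0// ltW.
have jt : 2 ^+ j * t <= 8 by exact: level_mul_le.
have amp : `|amplitude j| <= 2 ^+ j.
  apply: (le_trans (norm_amplitude_le j)).
  by rewrite ler_piMl// invf_le1 ?exprn_gt0// exprn_ege1// ler1n.
set q := (4 ^ block j)%N in aj *.
have /andP[_ tl] := level_bounds _ tt.
have td : t <= dyadic (2 * q).
  by apply: (le_trans tl); apply: dyadic_anti; case/andP: aj.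
set x : R := 2 ^+ q.
have x1 : 1 <= x by rewrite exprn_ege1// ler1n.
have x0 : 0 < x by lra.
have fx : (frequency j)%:R = 16 * x ^+ 3 :> R.
  rewrite /frequency natrX exprD mulnC exprM -/q -/x; ring.
have sx : Num.sqrt t * x <= 3.
  rewrite -ler_pdivlMr//; apply: le_trans (sqrt_dyadic_double_le q).
  exact: ler_wsqrtr.
have tx : t * x ^+ 2 <= 9.
  rewrite -ler_pdivlMr ?exprn_gt0//; apply: (le_trans td).
  by have := dyadic_double_le q; rewrite expr_div_n (_ : 3 ^+ 2 = 9)//; ring.
rewrite ler_pdivlMr// normrM.
have w := wave_le (frequency j) t (ltW t0).
set s := Num.sqrt t in s0 sx *.
have A : `|amplitude j| * `|wave (frequency j) t| <=
    2 ^+ j * ((frequency j)%:R * (t ^+ 2 / 2) + t) by apply: ler_pM.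
have B : 2 ^+ j * ((frequency j)%:R * (t ^+ 2 / 2) + t) =
    (2 ^+ j * t) * (8 * x ^+ 3 * t + 1) by rewrite fx; field.
(* With t x^2 <= 9 and s x <= 3 the product is at most 8 * 27 + 3. *)
have D : (8 * x ^+ 3 * t + 1) * s <= 220.
  have e : (8 * x ^+ 3 * t) * s = 8 * (t * x ^+ 2) * (s * x) by ring.
  have s3 : s <= 3 by nra.
  have tx0 : 0 <= t * x ^+ 2 by rewrite mulr_ge0 ?(ltW t0)// exprn_ge0// ltW.
  have txs : (t * x ^+ 2) * (s * x) <= 9 * 3.
    by apply: ler_pM => //; rewrite mulr_ge0// ltW.
  rewrite mulrDl mul1r; lra.
have u0 : 0 <= (8 * x ^+ 3 * t + 1) * s.
  by rewrite mulr_ge0 ?(ltW s0)// addr_ge0// !mulr_ge0 ?(ltW t0)// exprn_ge0// ltW.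
have F : (2 ^+ j * t) * ((8 * x ^+ 3 * t + 1) * s) <= 8 * 220.
  by apply: ler_pM => //; rewrite mulr_ge0 ?(ltW t0)// exprn_ge0.
apply: le_trans (ler_wpM2r (ltW s0) A) _; rewrite B -[leLHS]mulrA.
by apply: (le_trans F); rewrite CE; lra.
Qed.

Lemma gliding_hump_inactive t : ~~ active (level t) -> gliding_hump t = 0.
Proof.
by rewrite /gliding_hump /staircase /amplitude => /negbTE ->; rewrite mul0r.
Qed.

Lemma gliding_hump_le0 t : t <= 0 -> gliding_hump t = 0.
Proof. by move=> t0; apply: gliding_hump_inactive; rewrite level_le0. Qed.

Lemma gliding_hump_gt_pihalf t : pi / 2 < t <= pi *+ 2 -> gliding_hump t = 0.
Proof.
move=> /andP[pt t2]; apply: gliding_hump_inactive.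
have : (level t < 2)%N.
  apply: level_lt; rewrite t2 andbT (le_lt_trans _ pt)// /dyadic.
  by rewrite -mulr_natr; lra.
by rewrite ltnNge; apply: contra => /active_ge2.
Qed.

Lemma measurable_gliding_hump : measurable_fun `]0, pi *+ 2] gliding_hump.
Proof. exact: measurable_staircase. Qed.

Lemma integrable_gliding_hump h : h <= pi *+ 2 ->
  mu.-integrable `]0, h] (EFin \o gliding_hump).
Proof.
move=> h2; have [C C0 exC] := gliding_hump_bound.
exact: (integrable_staircase _ _ C C0 exC).
Qed.

Lemma norm_Rintegral_gliding_hump h : 0 < h <= pi *+ 2 ->
  `|\int[mu]_(t in `]0, h]) gliding_hump t| <= 4 * 2 ^- block (level h) * h.
Proof.
move=> hh; have /andP[h0 _] := hh.
have [C C0 exC] := gliding_hump_bound.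
rewrite (Rintegral_staircase _ _ C frequency_dyadic C0 exC)//.
rewrite normrM.
have := norm_amplitude_le (level h).
have := wave_primitive_le (frequency (level h)) h.
have := level_mul_le _ hh.
set w := `|wave_primitive _ _|; set e := 2 ^- _; set p := 2 ^+ _; set A := `|amplitude _|.
move=> ph wh Ae.
have e0 : 0 <= e by rewrite invr_ge0 exprn_ge0.
have A0 : 0 <= A by exact: normr_ge0.
have w0 : 0 <= w by exact: normr_ge0.
apply: le_trans (_ : e * p * (h ^+ 2 / 2) <= _); first exact: ler_pM.
have : (p * h) * (e * h) <= 8 * (e * h) by rewrite ler_wpM2r// mulr_ge0// ltW.
lra.
Qed.

End GlidingHump.

(** * Growth of the Fejer means along the resonant orders *)
Section Divergence.
Context {R : realType}.
Local Notation mu := (@lebesgue_measure R).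
Implicit Types (t h : R) (j k n : nat).

Definition fejer_integrand n t : R := gliding_hump t * fejer_kernel n t.

Lemma measurable_fejer_integrand n :
  measurable_fun `]0, pi *+ 2] (fejer_integrand n).
Proof.
by apply: measurable_funM;
  [exact: measurable_gliding_hump | exact: measurable_fejer_kernel].
Qed.

Lemma integrable_fejer_integrand n h : h <= pi *+ 2 ->
  mu.-integrable `]0, h] (EFin \o fejer_integrand n).
Proof.
move=> h2; have [C C0 exC] := @gliding_hump_bound R.
have : mu.-integrable `]0, pi *+ 2] (EFin \o fejer_integrand n).
  apply: (integrable_dominated_invsqrt _ (C * (2 * n.+1%:R))) => //.
  - exact: pi2_gt0.
  - by rewrite mulr_ge0// mulr_ge0.
  - exact: measurable_fejer_integrand.
  - move=> t; rewrite in_itv/= => tt; rewrite normrM mulrAC.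
    by apply: ler_pM => //; [exact: exC | exact: fejer_kernel_le].
by move=> i; apply: integrableS i => //; exact: subset_itvl.
Qed.

Lemma integrable_fejer_integrand_oc n a b : 0 <= a -> b <= pi *+ 2 ->
  mu.-integrable `]a, b] (EFin \o fejer_integrand n).
Proof.
move=> a0 b2; have := integrable_fejer_integrand n b b2.
by move=> i; apply: integrableS i => //; exact: subset_itvr.
Qed.

(** The order n for which n + 1 is the frequency of the k-th block. *)
Definition resonant_order k := (2 ^ (3 * 4 ^ k + 4)).-1.

Lemma resonant_orderE k : (resonant_order k).+1 = (2 ^ (3 * 4 ^ k + 4))%N.
Proof. by rewrite prednK// expn_gt0. Qed.

Lemma resonant_order_natE k :
  (resonant_order k).+1%:R = 16 * (2 ^+ (4 ^ k)) ^+ 3 :> R.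
Proof. by rewrite resonant_orderE natrX exprD mulnC exprM; ring. Qed.

(** With M = n + 1 the frequency of the block, multiplying the wave by the
    kernel gives cos(Mt) - cos(Mt)^2 up to the term sin t sin(Mt) K(t). Since
    |K(t)| <= 16 / (M t^2), that term is at most 16 / (M t) <= 1/4. *)
Lemma fejer_integrand_resonant_ge k j t : (2 * 4 ^ k <= j < 3 * 4 ^ k)%N ->
  dyadic j.+1 < t <= dyadic j ->
  2 ^- k * 2 ^+ j * (cos ((resonant_order k).+1%:R * t) ^+ 2
    - cos ((resonant_order k).+1%:R * t) - 1 / 4)
  <= fejer_integrand (resonant_order k) t.
Proof.
move=> jk jt; have /andP[tl tr] := jt.
have [bj aj] := active_block j k jk.
have t0 : 0 < t by rewrite (lt_trans (dyadic_gt0 _) tl).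
set n := resonant_order k; set M : R := n.+1%:R.
have M0 : 0 < M by rewrite ltr0n.
have j2 := active_ge2 _ aj.
have tpi : t <= pi / 2.
  apply: (le_trans tr); apply: (le_trans (dyadic_anti _ _ j2)).
  by rewrite /dyadic -mulr_natr; have := @pi_gt0 R; lra.
have c1 : 0 < 1 - cos t.
  by apply: lt_le_trans (oneBcos_ge t _); rewrite ?divr_gt0 ?exprn_gt0 ?(ltW t0).
have KE := fejer_kernelE n t; rewrite -/M in KE.
have Kd : `|fejer_kernel n t| <= 16 / (M * t ^+ 2).
  by apply: fejer_kernel_decay; rewrite t0.
rewrite /fejer_integrand /gliding_hump (staircaseE _ _ j t jt).
rewrite /amplitude aj bj /frequency bj -resonant_orderE -/n /wave -/M.
have Mt : 64 <= M * t.
  have d : pi / 2 ^+ j < t.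
    rewrite (_ : pi / 2 ^+ j = dyadic j.+1)//.
    by rewrite /dyadic exprS -mulr_natr; field; rewrite expf_neq0.
  (* M = 2^(3q + 4) and j < 3q. *)
  have M2 : 32 * 2 ^+ j <= M.
    rewrite /M resonant_orderE natrX (_ : 32 = 2 ^+ 5); last by ring.
    by rewrite -exprD ler_weXn2l ?ler1n//; case/andP: jk; lia.
  have p2 := @pi_ge2 R.
  have e0 : 0 < 2 ^+ j :> R by rewrite exprn_gt0.
  have td : 2 <= 2 ^+ j * t.
    by rewrite mulrC -ler_pdivrMr//; apply: le_trans (ltW d); rewrite ler_pM2r ?invr_gt0.
  have : 32 * 2 ^+ j * t <= M * t by rewrite ler_pM2r.
  lra.
have sK : `|sin t * sin (M * t) * fejer_kernel n t| <= 1 / 4.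
  rewrite !normrM.
  have A : `|sin t| * `|sin (M * t)| <= t * 1.
    apply: ler_pM => //; last exact: sin_max.
    by have := norm_sin_le t; rewrite (ger0_norm (ltW t0)).
  apply: (@le_trans _ _ (t * 1 * (16 / (M * t ^+ 2)))); first exact: ler_pM.
  rewrite (_ : t * 1 * _ = 16 / (M * t)); last by field; rewrite !gt_eqF.
  by rewrite ler_pdivrMr ?mulr_gt0//; lra.
set K := fejer_kernel n t in KE sK *; set E := 2 ^- k * 2 ^+ j.
have E0 : 0 <= E by rewrite mulr_ge0// invr_ge0 exprn_ge0.
have -> : - E * (M * (1 - cos t) * cos (M * t) + sin t * sin (M * t)) * K =
   E * (- (M * cos (M * t) * ((1 - cos t) * K)) - sin t * sin (M * t) * K) by ring.
rewrite KE ler_wpM2l//.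
have -> : M * cos (M * t) * ((1 - cos (M * t)) / M) = cos (M * t) - cos (M * t) ^+ 2.
  by field; rewrite gt_eqF.
by move: sK; rewrite ler_norml => /andP[_ sK]; lra.
Qed.

(** The square of the cosine has mean 1/2 over whole half periods, of which the
    constant 1/4 removes one half. *)
Lemma Rintegral_cos2_bump n a b : a <= b ->
  sin (n.+1%:R * a) = 0 -> sin (n.+1%:R * b) = 0 ->
  \int[mu]_(t in `]a, b])
     (cos (n.+1%:R * t) ^+ 2 - cos (n.+1%:R * t) - 1 / 4 : R) = (b - a) / 4.
Proof.
move=> ab sa sb; set M : R := n.+1%:R in sa sb *.
have M0 : M != 0 by rewrite pnatr_eq0.
pose P t : R := t / 4 - sin (M * t) / M + sin (M * t) * cos (M * t) / (2 * M).
(* cos^2 has the primitive t/2 + sin cos / (2M); the terms in sine vanish at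
   both ends. *)
transitivity (P b - P a); last first.
  by rewrite /P sa sb !mul0r !subr0 !addr0 -mulrBl.
apply: Rintegral_oc_FTC => //.
- apply: continuous_subspaceT => t; apply: cvgB; last exact: cvg_cst.
  apply: cvgB; last exact: continuous_cos_scaled.
  by apply: cvgM; exact: continuous_cos_scaled.
- move=> t _; apply: is_derive_eq; rewrite /GRing.scale/=.
  have := sin2cos2 (M * t); set s := sin _; set c := cos _ => sc.
  have -> : c ^+ 2 - c - 1 / 4 = 1 / 4 - c + (c ^+ 2 - (1 - c ^+ 2)) / 2 by field.
  by rewrite -sc; field.
Qed.

Lemma Rintegral_fejer_resonant_ge k j : (2 * 4 ^ k <= j < 3 * 4 ^ k)%N ->
  2 ^- k / 2 <=
  \int[mu]_(t in `]dyadic j.+1, dyadic j]) fejer_integrand (resonant_order k) t.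
Proof.
move=> jk; set n := resonant_order k.
set g := fun t : R => cos (n.+1%:R * t) ^+ 2 - cos (n.+1%:R * t) - 1 / 4.
have cg : continuous g.
  move=> t; apply: cvgB; last exact: cvg_cst.
  apply: cvgB; last exact: continuous_cos_scaled.
  by apply: cvgM; exact: continuous_cos_scaled.
have dj : dyadic j.+1 <= dyadic j :> R by rewrite dyadic_anti.
have sin_end i : (i <= j.+1)%N -> sin (n.+1%:R * dyadic i) = 0 :> R.
  move=> ij; have : (2 ^ i %| n.+1)%N.
    rewrite resonant_orderE dvdn_exp2l//.
    by case/andP: jk; lia.
  move=> /dvdnP[m ->]; rewrite natrM natrX -mulrA [2 ^+ i * _]mulrC dyadicM mulrC.
  exact: sin_2pi_nat.
apply: (@le_trans _ _ (\int[mu]_(t in `]dyadic j.+1, dyadic j]) (2 ^- k * 2 ^+ j * g t))).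
  rewrite RintegralZl//; last first.
    exact/integrable_oc_within/continuous_subspaceT.
  rewrite Rintegral_cos2_bump// ?sin_end//.
  rewrite dyadic_half (_ : dyadic j.+1 * 2 - dyadic j.+1 = dyadic j.+1); last by ring.
  have -> : 2 ^- k * 2 ^+ j * (dyadic j.+1 / 4) = 2 ^- k * (dyadic j.+1 * 2 ^+ j.+1 / 8) :> R.
    by rewrite exprS; field; rewrite expf_neq0.
  rewrite dyadicM ler_wpM2l ?invr_ge0 ?exprn_ge0//.
  by rewrite -mulr_natr; have := @pi_ge2 R; lra.
apply: le_Rintegral => //.
- apply: integrable_oc_within; apply: continuous_subspaceT => t.
  by apply: cvgM; [exact: cvg_cst | exact: cg].
- by apply: integrable_fejer_integrand_oc; rewrite ?dyadic_le2pi// ltW ?dyadic_gt0.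
- by move=> t; rewrite /= in_itv/=; exact: fejer_integrand_resonant_ge.
Qed.

(** Each of the 4^k active levels of the block contributes at least 2^-k / 2. *)
Lemma Rintegral_fejer_main k :
  2 ^+ k / 2 <= \int[mu]_(t in `]dyadic (3 * 4 ^ k), dyadic (2 * 4 ^ k)])
    fejer_integrand (resonant_order k) t.
Proof.
set q := (4 ^ k)%N; set g := fejer_integrand _.
have step m : (m <= q)%N -> m%:R * (2 ^- k / 2) <=
    \int[mu]_(t in `]dyadic (2 * q + m), dyadic (2 * q)]) g t.
  elim: m => [_|m IH mq]; first by rewrite addn0 set_itvoc0 Rintegral_set0 mul0r.
  rewrite (@Rintegral_oc_cat _ _ _ (dyadic (2 * q + m))).
  - rewrite -natr1 mulrDl mul1r addrC addnS lerD//; last exact/IH/ltnW.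
    by apply: Rintegral_fejer_resonant_ge; rewrite -/q; lia.
  - by rewrite !dyadic_anti//; lia.
  - by apply: integrable_fejer_integrand_oc; rewrite ?dyadic_le2pi// ltW ?dyadic_gt0.
have -> : (3 * q = 2 * q + q)%N by lia.
apply: le_trans (step q (leqnn q)).
rewrite /q natrX (_ : 4 = 2 ^+ 2 :> R); last by ring.
by rewrite -exprM mulnC exprM mulrA expr2 mulfK// expf_neq0.
Qed.

(** To the right of the k-th block the hump lives on earlier blocks, hence at
    points so far from 0 that the kernel of the resonant order is at most 1. *)
Lemma fejer_integrand_high_le k t :
  dyadic (2 * 4 ^ k) < t <= pi *+ 2 ->
  `|fejer_integrand (resonant_order k) t| <= `|gliding_hump t|.
Proof.
move=> kt; have /andP[tl t2] := kt.
have t0 : 0 < t by rewrite (lt_trans (dyadic_gt0 _) tl).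
have [aj|] := boolP (active (level t)); last first.
  by move=> /gliding_hump_inactive e0; rewrite /fejer_integrand e0 mul0r.
have jk := level_lt _ _ kt; have qk := active_below _ _ aj jk.
have tt : 0 < t <= pi *+ 2 by rewrite t0.
have /andP[jt tj] := level_bounds _ tt.
have tpi : t <= pi / 2.
  apply: (le_trans tj); apply: (le_trans (dyadic_anti _ _ (active_ge2 _ aj))).
  by rewrite /dyadic -mulr_natr; have := @pi_gt0 R; lra.
rewrite /fejer_integrand normrM ler_piMr//.
apply: le_trans (fejer_kernel_decay _ _ _) _; first by rewrite t0.
set M : R := _.+1%:R; have M0 : 0 < M by rewrite ltr0n.
rewrite ler_pdivrMr ?mul1r ?mulr_gt0 ?exprn_gt0//.
set q := (4 ^ block (level t))%N in qk.
have tq : 1 <= 2 ^+ (3 * q) * t.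
  rewrite mulrC -ler_pdivrMr ?exprn_gt0//.
  apply: (@le_trans _ _ (dyadic (3 * q))).
    rewrite ler_pM2r ?invr_gt0 ?exprn_gt0//.
    by rewrite -mulr_natr; have := @pi_ge2 R; lra.
  apply: le_trans (ltW jt); apply: dyadic_anti.
  by case/andP: aj.
(* An earlier block has at most a quarter of the size, so that 6q is below
   the exponent 3 * 4^k of M. *)
have Mq : 16 * (2 ^+ (3 * q)) ^+ 2 <= M.
  rewrite /M resonant_order_natE ler_pM2l// -!exprM ler_weXn2l ?ler1n//.
  lia.
have : 1 <= (2 ^+ (3 * q) * t) ^+ 2 by rewrite exprn_ege1.
have : 16 * (2 ^+ (3 * q)) ^+ 2 * t ^+ 2 <= M * t ^+ 2.
  by rewrite ler_pM2r ?exprn_gt0.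
by rewrite exprMn; lra.
Qed.

Lemma Rintegral_fejer_high : exists D : R, forall k,
  `|\int[mu]_(t in `]dyadic (2 * 4 ^ k), pi])
      fejer_integrand (resonant_order k) t| <= D.
Proof.
have [C C0 exC] := @gliding_hump_bound R.
have p0 := @pi_gt0 R; have p2 : (pi : R) <= pi *+ 2 by rewrite -mulr_natr; lra.
exists (2 * C * Num.sqrt pi) => k.
apply: norm_Rintegral_dominated_invsqrt => //.
- exact: dyadic_gt0.
- apply: (@le_trans _ _ (dyadic 1)).
    by apply: dyadic_anti; have := expn_gt0 4 k => /=; lia.
  by rewrite dyadic1.
- by apply: integrable_fejer_integrand_oc => //; rewrite ltW ?dyadic_gt0.
- move=> t; rewrite in_itv/= => /andP[kt tp].
  have t2 := le_trans tp p2.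
  apply: le_trans (fejer_integrand_high_le k t _) _; first by rewrite kt.
  by apply: exC; rewrite (lt_trans (dyadic_gt0 _) kt).
Qed.

(** To the left of the k-th block the hump vanishes down to dyadic (8q), where
    q = 4^k. On the rest the crude bound 2 (n + 1) = 32 * 8^q on the kernel is
    beaten by the square root of dyadic (8q), which is of the order of 16^-q. *)
Lemma Rintegral_fejer_low : exists D : R, forall k,
  `|\int[mu]_(t in `]0, dyadic (3 * 4 ^ k)])
      fejer_integrand (resonant_order k) t| <= D.
Proof.
have [C C0 exC] := @gliding_hump_bound R.
exists (192 * C) => k; set q := (4 ^ k)%N.
rewrite (@Rintegral_oc_cat _ _ _ (dyadic (8 * q))); last 2 first.
- by rewrite ltW ?dyadic_gt0// dyadic_anti//; lia.
- exact/integrable_fejer_integrand/dyadic_le2pi.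
rewrite [X in _ + X](_ : _ = 0) ?addr0; last first.
  transitivity (\int[mu]_(t in `](dyadic (8 * q) : R), dyadic (3 * q)]) (0 : R)).
    apply: eq_Rintegral => t; rewrite inE/= in_itv/= => /andP[tl tr].
    have t0 : 0 < t by rewrite (lt_trans (dyadic_gt0 _) tl).
    rewrite /fejer_integrand gliding_hump_inactive ?mul0r//.
    apply: (inactive_gap _ k); rewrite level_max ?t0//=.
    by apply: level_lt; rewrite tl (le_trans tr)// dyadic_le2pi.
  by rewrite Rintegral_cst// mul0r.
set M : R := (resonant_order k).+1%:R.
apply: (@le_trans _ _ (2 * (C * (2 * M)) * Num.sqrt (dyadic (8 * q)))).
  apply: norm_Rintegral0_dominated_invsqrt => //.
  - exact: dyadic_gt0.
  - by rewrite !mulr_ge0.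
  - apply: measurable_funS (measurable_fejer_integrand _) => //.
    by apply: subset_itvl; rewrite bnd_simp dyadic_le2pi.
  - move=> t; rewrite in_itv/= => /andP[t0 tk].
    rewrite normrM mulrAC; apply: ler_pM => //.
      by apply: exC; rewrite t0 (le_trans tk)// dyadic_le2pi.
    exact: fejer_kernel_le.
set x : R := 2 ^+ q.
have x1 : 1 <= x by rewrite exprn_ege1// ler1n.
have x0 : 0 < x by lra.
have sq : Num.sqrt (dyadic (8 * q)) <= 3 / x ^+ 4 :> R.
  have -> : (8 * q = 2 * (4 * q))%N by lia.
  apply: (le_trans (sqrt_dyadic_double_le _)).
  by rewrite mulnC exprM.
apply: (@le_trans _ _ (2 * (C * (2 * M)) * (3 / x ^+ 4))).
  by rewrite ler_wpM2l// !mulr_ge0.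
rewrite /M resonant_order_natE -/x.
have -> : 2 * (C * (2 * (16 * x ^+ 3))) * (3 / x ^+ 4) = 192 * C / x.
  by field; rewrite gt_eqF.
rewrite ler_pdivrMr// ler_peMr//.
by rewrite mulr_ge0 ?ler0n.
Qed.

Lemma Rintegral_fejer_resonant : exists D : R, forall k,
  2 ^+ k / 2 - D <=
  \int[mu]_(t in `]0, pi]) fejer_integrand (resonant_order k) t.
Proof.
have [D1 low] := Rintegral_fejer_low; have [D2 high] := Rintegral_fejer_high.
exists (D1 + D2) => k; have main := Rintegral_fejer_main k.
move: (low k) (high k); rewrite !ler_norml => /andP[{}low _] /andP[{}high _].
have p0 := @pi_gt0 R; have p2 : (pi : R) <= pi *+ 2 by rewrite -mulr_natr; lra.
have q0 : (0 < 4 ^ k)%N by rewrite expn_gt0.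
have dpi : dyadic (2 * 4 ^ k) <= pi :> R.
  apply: (@le_trans _ _ (dyadic 1)); first by apply: dyadic_anti; lia.
  by rewrite dyadic1.
rewrite (@Rintegral_oc_cat _ _ _ (dyadic (2 * 4 ^ k))); last 2 first.
- by rewrite ltW ?dyadic_gt0.
- exact: integrable_fejer_integrand.
rewrite (@Rintegral_oc_cat _ _ _ (dyadic (3 * 4 ^ k))); last 2 first.
- by rewrite ltW ?dyadic_gt0//= dyadic_anti//; lia.
- exact/integrable_fejer_integrand/dyadic_le2pi.
lra.
Qed.

End Divergence.

(** * Passage to complex-valued functions on the circle *)
Section Circle.
Context {R : realType}.
Local Notation mu := (@lebesgue_measure R).
Implicit Types (g : R -> R) (t h : R) (n : nat).
Local Open Scope complex_scope.

(** The representative of t modulo 2 pi in [-pi, pi[. *)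
Definition wrap t : R := t - pi *+ 2 * (Num.floor ((t + pi) / (pi *+ 2)))%:~R.

Lemma periodic_wrap : periodic wrap (pi *+ 2).
Proof.
move=> t; rewrite /wrap.
have p2 : pi *+ 2 != 0 :> R by rewrite gt_eqF// pi2_gt0.
have -> : (t + pi *+ 2 + pi) / (pi *+ 2) = (t + pi) / (pi *+ 2) + 1.
  by rewrite addrAC mulrDl divff.
by rewrite floorDrz ?int_num1// floor1 intrD; ring.
Qed.

Lemma wrap_id t : - pi <= t < pi -> wrap t = t.
Proof.
move=> /andP[tl tr]; rewrite /wrap (_ : Num.floor _ = 0) ?mulr0 ?subr0//.
apply: floor_def; rewrite add0r ler_pdivlMr ?pi2_gt0// ltr_pdivrMr ?pi2_gt0//.
by rewrite mul0r mul1r mulr2n; lra.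
Qed.

Lemma wrap_pi : wrap pi = - pi.
Proof.
rewrite /wrap -mulr2n divff ?gt_eqF ?pi2_gt0// floor1 mulr1 mulr2n; ring.
Qed.

Definition circle_hump t : R[i] := (gliding_hump (wrap t))%:C.

Lemma periodic_circle_hump : periodic circle_hump (pi *+ 2).
Proof. by move=> t; rewrite /circle_hump periodic_wrap. Qed.

(** At t = pi the representative is -pi; the hump vanishes at both ends. *)
Lemma gliding_hump_wrap t : - pi <= t <= pi -> gliding_hump (wrap t) = gliding_hump t.
Proof.
move=> /andP[tl]; rewrite le_eqVlt => /predU1P[->|tr]; last first.
  by rewrite wrap_id ?tl.
have p0 := @pi_gt0 R; have p2 : (pi : R) <= pi *+ 2 by rewrite -mulr_natr; lra.
rewrite wrap_pi gliding_hump_le0 ?oppr_le0 ?ltW// gliding_hump_gt_pihalf// p2 andbT.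
lra.
Qed.

Lemma cc_setI_oc : `[- pi, pi]%classic `&` `]0, pi]%classic = `](0 : R), pi]%classic.
Proof.
rewrite setIidr// => t /=; rewrite !in_itv/= => /andP[t0 ->].
by rewrite andbT (le_trans _ (ltW t0))// oppr_le0 ltW// pi_gt0.
Qed.

Lemma restrict_positive g : (forall t, t <= 0 -> g t = 0) ->
  {in `[- pi, pi]%classic, g \_ `]0, pi] =1 g}.
Proof.
move=> g0 t; rewrite inE/= in_itv/= => /andP[_ tpi]; rewrite patchE.
case: ifPn => //; rewrite notin_setE/= in_itv/= tpi andbT => /negP.
by rewrite -leNgt => /g0.
Qed.

Lemma Rintegral_positive g : (forall t, t <= 0 -> g t = 0) ->
  \int[mu]_(t in `[- pi, pi]) g t = \int[mu]_(t in `]0, pi]) g t.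
Proof.
move=> g0; rewrite -cc_setI_oc Rintegral_mkcondr.
by apply: eq_Rintegral => t /(restrict_positive g g0).
Qed.

Lemma integrable_positive g : (forall t, t <= 0 -> g t = 0) ->
  mu.-integrable `]0, pi] (EFin \o g) -> mu.-integrable `[- pi, pi] (EFin \o g).
Proof.
move=> g0; rewrite -cc_setI_oc => /integrable_restrict gi.
have := gi (measurable_itv _) (measurable_itv _).
apply: eq_integrable => // t tpi.
by rewrite restrict_EFin/= (restrict_positive g g0).
Qed.

Lemma L1T_circle_hump : L1T circle_hump.
Proof.
split; first exact: periodic_circle_hump.
have p0 := @pi_gt0 R; have p2 : (pi : R) <= pi *+ 2 by rewrite -mulr_natr; lra.
split.
  have : mu.-integrable `[- pi, pi] (EFin \o (@gliding_hump R)).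
    apply: integrable_positive; first exact: gliding_hump_le0.
    exact: integrable_gliding_hump.
  apply: eq_integrable => // t; rewrite inE/= in_itv/= => tt.
  by rewrite /= gliding_hump_wrap.
exact: integrable0.
Qed.

Lemma Re_sum (I : Type) (r : seq I) (F : I -> R[i]) :
  complex.Re (\sum_(i <- r) F i) = \sum_(i <- r) complex.Re (F i).
Proof.
elim: r => [|i r IH]; first by rewrite !big_nil.
by rewrite !big_cons -IH; case: (F i) => a b; case: (\sum_(_ <- _) _).
Qed.

Lemma Re_scale (a : R) (z : R[i]) : complex.Re (a%:C * z) = a * complex.Re z.
Proof. by case: z => x y /=; rewrite mul0r subr0. Qed.

Lemma Re_fejer_term (a b : R) (z : R[i]) :
  complex.Re (a%:C * z * expi (b * 0)) = a * complex.Re z.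
Proof. by rewrite mulr0 /expi cos0 sin0 mulr1 Re_scale. Qed.

Lemma Re_fourier_coef (k : int) :
  complex.Re (fourier_coef circle_hump k) =
  (pi *+ 2)^-1 * \int[mu]_(t in `]0, pi]) (gliding_hump t * cos (k%:~R * t)).
Proof.
rewrite /fourier_coef Re_scale; congr (_ * _) => /=.
rewrite -Rintegral_positive; last by move=> t t0; rewrite gliding_hump_le0// mul0r.
apply: eq_Rintegral => t; rewrite inE/= in_itv/= => tt.
by rewrite gliding_hump_wrap// mul0r subr0 cosN.
Qed.

Lemma Rintegral_sum (I : Type) (r : seq I) (D : set R) (F : I -> R -> R) :
  measurable D -> (forall i, mu.-integrable D (EFin \o F i)) ->
  \int[mu]_(t in D) (\sum_(i <- r) F i t) =
  \sum_(i <- r) \int[mu]_(t in D) F i t.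
Proof.
move=> mD Fi.
have Si s : mu.-integrable D (EFin \o (fun t => \sum_(i <- s) F i t)).
  elim: s => [|i s IH].
    have -> : EFin \o (fun t => \sum_(i <- [::]) F i t) = cst 0%E.
      by apply/funext => t /=; rewrite big_nil.
    exact: integrable0.
  have -> : EFin \o (fun t => \sum_(i <- i :: s) F i t) =
      ((EFin \o F i) \+ (EFin \o (fun t => (\sum_(i <- s) F i t)%R)))%E.
    by apply/funext => t /=; rewrite big_cons.
  exact: integrableD.
elim: r => [|i r IH].
  rewrite big_nil (_ : (fun t => _) = (fun=> 0)); last first.
    by apply/funext => t; rewrite big_nil.
  by rewrite Rintegral_cst// mul0r.
rewrite big_cons -IH -RintegralD//.
by apply: eq_Rintegral => t _; rewrite big_cons.
Qed.

Lemma integrable_gliding_hump_cos (a : R) :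
  mu.-integrable `]0, pi] (EFin \o (fun t => gliding_hump t * cos (a * t))).
Proof.
have p0 := @pi_gt0 R; have p2 : (pi : R) <= pi *+ 2 by rewrite -mulr_natr; lra.
have ie := integrable_gliding_hump pi p2.
apply: le_integrable ie => //.
  apply/measurable_EFinP; apply: measurable_funM.
    by apply: measurable_funS (@measurable_gliding_hump R) => //; exact: subset_itvl.
  apply: measurable_funTS; apply: measurableT_comp.
    exact: (continuous_measurable_fun (@continuous_cos R)).
  exact: mulrl_measurable.
by move=> t _; rewrite lee_fin normrM ler_piMr// cos_max.
Qed.

Lemma Re_fejer_mean n : complex.Re (fejer_mean circle_hump n 0) =
  (pi *+ 2)^-1 * \int[mu]_(t in `]0, pi]) fejer_integrand n t.
Proof.
rewrite /fejer_mean Re_sum.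
transitivity ((pi *+ 2)^-1 * \sum_(i < n.*2.+1)
    \int[mu]_(t in `]0, pi])
      ((1 - `|i%:Z - n%:Z|%:~R / n.+1%:R) * (gliding_hump t * cos ((i%:Z - n%:Z)%:~R * t)))).
  rewrite mulr_sumr; apply: eq_bigr => i _.
  apply: etrans (Re_fejer_term _ _ _) _; rewrite Re_fourier_coef RintegralZl//.
    by rewrite mulrCA.
  exact: integrable_gliding_hump_cos.
rewrite -Rintegral_sum//.
  congr (_ * _); apply: eq_Rintegral => t _.
  by rewrite /fejer_integrand /fejer_kernel mulr_sumr; apply: eq_bigr => i _; ring.
move=> i.
have := integrable_gliding_hump_cos ((i%:Z - n%:Z)%:~R).
by move=> /(integrableZl _ (1 - `|i%:Z - n%:Z|%:~R / n.+1%:R)); exact.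
Qed.

End Circle.

(** * The point 0 and the conclusion *)
Section DPoint.
Context {R : realType}.
Local Notation mu := (@lebesgue_measure R).
Local Open Scope complex_scope.

(** The block of h tends to infinity as h tends to 0 from the right. *)
Lemma level_block_small (e : R) : 0 < e ->
  exists2 d : R, 0 < d <= pi & forall h, 0 < h <= d ->
    4 * 2 ^- block (level h) < e.
Proof.
move=> e0; set k := (Num.truncn (4 / e)).+1.
exists (dyadic (4 ^ k)).
  rewrite dyadic_gt0 -dyadic1 dyadic_anti//.
  by rewrite expn_gt0.
move=> h hd; have lk : (k <= block (level h))%N.
  by apply: trunc_log_max => //; exact: level_max.
apply: (@le_lt_trans _ _ (4 * 2 ^- k)).
  rewrite ler_pM2l// lef_pV2 ?posrE ?exprn_gt0//.
  by rewrite ler_weXn2l// ler1n.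
rewrite ltr_pdivrMr ?exprn_gt0// mulrC -ltr_pdivrMr//.
apply: (lt_le_trans (truncnS_gt _)); rewrite -/k.
by rewrite -natrX ler_nat ltnW// ltn_expl.
Qed.

Lemma Cintegral_oriented_gliding_hump (h : R) : `|h| <= pi ->
  Cintegral_oriented 0 h (fun t => circle_hump (0 + t)) =
  (\int[mu]_(t in `]0, h]) gliding_hump t)%:C.
Proof.
move=> hpi; have /andP[hl hr] : - pi <= h <= pi by rewrite -ler_norml.
have p0 := @pi_gt0 R; have p2 : (pi : R) <= pi *+ 2 by rewrite -mulr_natr; lra.
rewrite /Cintegral_oriented /Cintegral /=.
have [h0|h0] := leP 0 h.
  rewrite Rintegral_cst// mul0r; congr (_ +i* _).
  rewrite Rintegral_itv_obnd_cbnd; last exact/integrable_gliding_hump/(le_trans hr).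
  apply: eq_Rintegral => t; rewrite inE/= in_itv/= => /andP[t0 th].
  by rewrite add0r gliding_hump_wrap// (le_trans th)// andbT (le_trans _ t0)// oppr_le0 ltW.
rewrite [`]0, h]%classic]set_itv_ge ?bnd_simp -?leNgt ?ltW// Rintegral_set0.
rewrite Rintegral_cst// mul0r (_ : Rintegral _ _ _ = 0).
  by apply/eqP; rewrite eq_complex/= !oppr0 !eqxx.
rewrite -[RHS](mul0r (fine (mu `[h, 0]))) -Rintegral_cst//.
apply: eq_Rintegral => t; rewrite inE/= in_itv/= => /andP[th t0].
rewrite add0r gliding_hump_wrap ?gliding_hump_le0//.
by rewrite (le_trans hl)//= (le_trans t0)// ltW.
Qed.

Lemma normc_real (x : R) : `|x%:C| = `|x|%:C.
Proof. by rewrite normc_def /= expr0n addr0 sqrtr_sqr. Qed.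

Lemma d_point_circle_hump : d_point (@circle_hump R) 0.
Proof.
apply/cvg_ex; exists 0; apply/cvgr0Pnorm_lt => e.
rewrite ltcE => /= /andP[/eqP ei e0].
have -> : e = (complex.Re e)%:C by apply/eqP; rewrite eq_complex /= ei !eqxx.
have [d /andP[d0 dpi] dP] := level_block_small (complex.Re e) e0.
near=> h.
have hd : `|h| <= d by near: h; exact: dnbhs0_le.
have h0 : h != 0 by near: h; exact: nbhs_dnbhs_neq.
rewrite Cintegral_oriented_gliding_hump ?(le_trans hd)//.
rewrite -rmorphM /= normc_real ltcR normrM normfV mulrC ltr_pdivrMr ?normr_gt0//.
have [hpos|hneg] := ltP 0 h; last first.
  by rewrite set_itv_ge ?bnd_simp -?leNgt// Rintegral_set0 normr0 mulr_gt0// normr_gt0.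
rewrite (gtr0_norm hpos) in hd *.
apply: le_lt_trans (norm_Rintegral_gliding_hump h _) _.
  by rewrite hpos (le_trans hd)// (le_trans dpi)// -mulr_natr; have := @pi_gt0 R; lra.
by rewrite ltr_pM2r// dP// hpos.
Unshelve. all: by end_near. Qed.

End DPoint.

Theorem corollary3p4 (R : realType) :
  exists f : R -> R[i],
    [/\ L1T f, d_point f 0 &
        ~ cvg ((fun n : nat => fejer_mean f n 0 : R[i]^o) @ \oo)].
Proof.
exists circle_hump; split.
- exact: L1T_circle_hump.
- exact: d_point_circle_hump.
move=> /cvg_ex[l /cvgrPdist_lt/(_ 1 ltr01)[n0 _ near_l]].
have [D resonant] := @Rintegral_fejer_resonant R.
(* If the means converged to l, their real parts would eventually be at most
   Re l + 1, which bounds 2^k. *)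
set B := pi *+ 2 * (complex.Re l + 1) + D.
have bound k : (n0 <= k)%N -> 2 ^+ k / 2 <= B.
  move=> nk; have nr : (n0 <= resonant_order k)%N.
    rewrite -ltnS resonant_orderE (leq_ltn_trans nk)//.
    apply: leq_ltn_trans (_ : 2 ^ k < _)%N; first exact/ltnW/ltn_expl.
    by rewrite ltn_exp2l//; have := @ltn_expl 4 k isT; lia.
  have := near_l _ nr.
  set z := fejer_mean _ _ _ => lz.
  have /ltW : complex.Re (z - l) < 1.
    rewrite (le_lt_trans (ler_norm _))// -(ltcR _ 1).
    by apply: le_lt_trans (normc_ge_Re _) _; rewrite distrC.
  rewrite (_ : complex.Re (z - l) = complex.Re z - complex.Re l); last by case: (z) (l) => ? ? [].
  rewrite lerBlDl /z Re_fejer_mean mulrC ler_pdivrMr ?pi2_gt0// mulrC.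
  by have := resonant k; rewrite /B; lra.
have B0 : 0 <= B by apply: le_trans (bound n0 (leqnn _)); rewrite divr_ge0// exprn_ge0.
have [k kn kB] : exists2 k, (n0 <= k)%N & 2 * B < k%:R.
  exists (maxn n0 (Num.truncn (2 * B)).+1); first exact: leq_maxl.
  by apply: (lt_le_trans (truncnS_gt _)); rewrite ler_nat leq_maxr.
have : k%:R <= 2 ^+ k :> R by rewrite -natrX ler_nat ltnW// ltn_expl.
by have := bound k kn; lra.
Qed.
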